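(* Let $q$ be a prime power, $m,n\ge 1$, and let $s\in\mathbb{N}$ with $s<m$ and $\gcd(s,m)=1$. Let $\mathcal{C}\subseteq\mathbb{F}_{q^m}^n$ be an $\mathbb{F}_{q^m}$-linear MRD code of dimension $k<n$. Then $\dim_{\mathbb{F}_{q^m}}(\mathcal{C}\cap\mathcal{C}^{[s]})=k-1$ if and only if $\mathcal{C}$ is a generalized Gabidulin code with parameter $s$.
   Context: Notation: $[i]:=q^i$; for $\mathcal{C}\subseteq\mathbb{F}_{q^m}^n$, $\mathcal{C}^{[s]}=\{\boldsymbol{c}^{[s]}\mid\boldsymbol{c}\in\mathcal{C}\}$, where the power $q^s$ is taken coordinate-wise. The rank over $\mathbb{F}_q$ of $\boldsymbol{x}=(x_1,\dots,x_n)\in\mathbb{F}_{q^m}^n$ is $\dim_{\mathbb{F}_q}\langle x_1,\dots,x_n\rangle_{\mathbb{F}_q}$, and the minimum rank distance of a nonzero linear code is the minimum rank of its nonzero codewords. A nonzero $\mathbb{F}_{q^m}$-linear code in $\mathbb{F}_{q^m}^n$ of dimension $k$ (over $\mathbb{F}_{q^m}$) is an MRD code if its minimum rank distance equals $n-k+1$. A generalized Gabidulin code of dimension $k$ with parameter $s$ (where $\gcd(s,m)=1$) is a linear code in $\mathbb{F}_{q^m}^n$ having a generator matrix whose $i$-th row is $(g_1^{[s(i-1)]},\dots,g_n^{[s(i-1)]})$ for $i=1,\dots,k$, for some $g_1,\dots,g_n\in\mathbb{F}_{q^m}$ that are linearly independent over $\mathbb{F}_q$. *)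

(* Defs.v *)
From HB Require Import structures.
From mathcomp Require Import all_boot all_order all_algebra all_field.

Set Implicit Arguments.
Unset Strict Implicit.
Unset Printing Implicit Defensive.

Import GRing.Theory.
Local Open Scope ring_scope.

(* F plays the role of F_q, so q = #|F|; the extension L, of degree m over F, *)
(* plays the role of F_{q^m}; linear codes are the L-subspaces of 'rV[L]_n.   *)
Section RankMetricCodes.

Variables (F : finFieldType) (L : fieldExtType F) (n : nat).

Implicit Types (x g : 'rV[L]_n) (C : {vspace 'rV[L]_n}).

Definition frobv (s : nat) x : 'rV[L]_n :=
  map_mx (fun a : L => a ^+ (#|F| ^ s)) x.

(* C^[s] as a subspace. As a set it is exactly the image of C under           *)
(* coordinate-wise powering, see frob_codeP below.                            *)
Definition frob_code (s : nat) C : {vspace 'rV[L]_n} :=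
  <<[seq frobv s c | c <- vbasis C]>>%VS.

(* The span and its dimension are over F, not over L. *)
Definition rank_weight x : nat :=
  \dim (<<[seq x 0%R i | i : 'I_n]>>%VS : {vspace L}).

Definition is_min_rank_distance C (d : nat) : Prop :=
  (exists c, [/\ c \in C, c != 0 & rank_weight c = d]) /\
  (forall c, c \in C -> c != 0 -> (d <= rank_weight c)%N).

(* The natural subtraction is never truncated, since \dim C <= n. *)
Definition is_MRD C : Prop :=
  C != 0%VS /\ is_min_rank_distance C (n - \dim C + 1)%N.

Definition is_generator_matrix (k : nat) (G : 'M[L]_(k, n)) C : Prop :=
  basis_of C [seq row i G | i : 'I_k].

(* Rows are numbered from 0, so row i is g^[s * i]. *)
Definition gabidulin_mx (k s : nat) g : 'M[L]_(k, n) :=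
  \matrix_(i < k) frobv (s * i)%N g.

Definition is_gen_gabidulin (k s : nat) C : Prop :=
  exists g, free [seq g 0%R i | i : 'I_n] /\
            is_generator_matrix (gabidulin_mx k s g) C.

Lemma frob_add s (a b : L) :
  (a + b) ^+ (#|F| ^ s) = a ^+ (#|F| ^ s) + b ^+ (#|F| ^ s).
Proof.
have [p p_pr pcharF] := finPcharP F.
have pcharL : p \in [pchar L] by rewrite pchar_lalg.
rewrite (card_pprimeChar pcharF) -expnM; apply: exprDn_pchar.
by rewrite (eq_pnat _ (pcharf_eq pcharL)) pnatX pnat_id ?p_pr.
Qed.

Lemma frob_surj s (a : L) : {b : L | b ^+ (#|F| ^ s) = a}.
Proof.
have fixL (c : L) j : c ^+ (#|F| ^ (\dim {:L} * j)) = c.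
  elim: j => [|j IHj]; first by rewrite muln0 expn0 expr1.
  rewrite mulnS expnD exprM.
  have /eqP -> : c ^+ (#|F| ^ \dim {:L}) == c; last exact: IHj.
  by rewrite -(Fermat's_little_theorem {:L}%AS) memvf.
exists (a ^+ (#|F| ^ (\dim {:L} * s - s))).
by rewrite -exprM -expnD subnK ?fixL // leq_pmull // (adim_gt0 {:L}%AS).
Qed.

Lemma frobv_sum s (I : finType) (u : I -> 'rV[L]_n) :
  frobv s (\sum_i u i) = \sum_i frobv s (u i).
Proof.
apply: (big_morph (frobv s)) => [x y|]; apply/rowP=> j; rewrite !mxE.
  exact: frob_add.
have q_gt0 : (0 < #|F| ^ s)%N by rewrite expn_gt0 (ltnW (finNzRing_gt1 F)).
by rewrite expr0n gtn_eqF.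
Qed.

Lemma frobvZ s (a : L) x : frobv s (a *: x) = a ^+ (#|F| ^ s) *: frobv s x.
Proof. by apply/rowP=> j; rewrite !mxE exprMn. Qed.

Lemma frob_codeP s C (v : 'rV[L]_n) :
  v \in frob_code s C <-> exists2 c, c \in C & v = frobv s c.
Proof.
split=> [|[c Cc ->]].
  rewrite /frob_code -[map _ _]/(tval (map_tuple _ _)) => /coord_span ->.
  pose b i := sval (frob_surj s (coord (map_tuple (frobv s) (vbasis C)) i v)).
  exists (\sum_i b i *: (vbasis C)`_i).
    apply: memv_suml => i _; apply/memvZ/vbasis_mem.
    by rewrite mem_nth ?size_tuple.
  rewrite frobv_sum; apply: eq_bigr => i _.
  by rewrite frobvZ (svalP (frob_surj _ _)) (nth_map 0) ?size_tuple.
rewrite (coord_vbasis Cc) frobv_sum; apply: memv_suml => i _.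
rewrite frobvZ; apply/memvZ/memv_span/map_f.
by rewrite mem_nth ?size_tuple.
Qed.

End RankMetricCodes.

(* Main.v *)
Require Import Defs.
From mathcomp Require Import all_boot all_order all_algebra all_field.

(** Write [sigma] for the coordinate-wise power q^s.  Since gcd(s, m) = 1, the
    fixed field of x |-> x^(q^s) in L is F, so a nonzero subspace stable under
    [sigma] contains a nonzero vector with entries in F (normalise a codeword c
    of minimal Hamming weight; then [sigma c - c] is lighter, hence zero).  Such
    a vector has rank 1, so an MRD code of dimension k < n has no nonzero
    [sigma]-stable subspace.  If C has this property and D, the intersection of
    C and [sigma C], has codimension 1 in C, then D has codimension 1 in
    [sigma C], hence D satisfies the same hypotheses; by induction D is spanned
    by h, sigma h, ..., and C is spanned by [sigma^-1 h] and D.  Finally, an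
    F-linear relation between the entries of g would hold for all codewords,
    and a codeword vanishing on k - 1 well chosen coordinates would then have
    rank at most n - k. *)

Set Implicit Arguments.
Unset Strict Implicit.
Unset Printing Implicit Defensive.

Import GRing.Theory.
Local Open Scope ring_scope.

Section FrobeniusOrbits.

Variables (F : finFieldType) (L : fieldExtType F) (n : nat).

Implicit Types (x g c : 'rV[L]_n) (C D : {vspace 'rV[L]_n}) (s t k : nat).

(** A list rather than a matrix, so that induction on the dimension can split off the first
    vector. *)
Definition frob_orbit s g k : seq 'rV[L]_n :=
  [seq frobv (s * i)%N g | i <- iota 0 k].

(** * Frobenius powers of vectors, codes and orbits *)

Lemma frobvD s t x : frobv s (frobv t x) = frobv (s + t) x.
Proof. by apply/rowP=> j; rewrite !mxE -exprM -expnD addnC. Qed.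

Lemma frobv0 x : frobv 0 x = x.
Proof. by apply/rowP=> j; rewrite !mxE expn0 expr1. Qed.

Lemma frobv_inverse s : exists t, cancel (@frobv F L n s) (frobv t).
Proof.
have fixL (a : L) j : a ^+ (#|F| ^ (\dim {:L} * j)) = a.
  elim: j => [|j IHj]; first by rewrite muln0 expn0 expr1.
  rewrite mulnS expnD exprM.
  have /eqP -> : a ^+ (#|F| ^ \dim {:L}) == a; last exact: IHj.
  by rewrite -(Fermat's_little_theorem {:L}%AS) memvf.
(* The exponents add up to a multiple of the degree of [L], and such a power of Frobenius is the
   identity on [L]. *)
exists (\dim {:L} * s - s)%N => x; rewrite frobvD subnK; last first.
  by rewrite leq_pmull // (adim_gt0 {:L}%AS).
by apply/rowP=> j; rewrite mxE fixL.
Qed.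

Lemma frob_code_mono s C D : (C <= D)%VS -> (frob_code s C <= frob_code s D)%VS.
Proof.
move=> /subvP sCD; apply/subvP=> _ /frob_codeP[c Cc ->].
by apply/frob_codeP; exists c => //; apply: sCD.
Qed.

Lemma dim_frob_code_leq s C : (\dim (frob_code s C) <= \dim C)%N.
Proof. by rewrite (leq_trans (dim_span _)) // size_map size_tuple. Qed.

Lemma dim_frob_code s C : \dim (frob_code s C) = \dim C.
Proof.
apply/eqP; rewrite eqn_leq dim_frob_code_leq /=.
have [t sK] := frobv_inverse s.
(* Applying the inverse power [t] to [frob_code s C] recovers every word of [C]. *)
apply: leq_trans (dim_frob_code_leq t _); apply: dimvS.
apply/subvP=> c Cc; apply/frob_codeP; exists (frobv s c); last by rewrite sK.
by apply/frob_codeP; exists c.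
Qed.

Lemma frob_code_span s (X : seq 'rV[L]_n) :
  frob_code s <<X>> = <<[seq frobv s x | x <- X]>>%VS.
Proof.
apply/eqP; rewrite eqEsubv; apply/andP; split; last first.
  apply/span_subvP=> _ /mapP[x Xx ->]; apply/frob_codeP.
  by exists x => //; apply: memv_span.
apply/subvP=> _ /frob_codeP[c /(@coord_span _ _ _ (in_tuple X)) -> ->].
rewrite frobv_sum; apply: memv_suml => i _; rewrite frobvZ.
by apply/memvZ/memv_span/map_f; rewrite mem_nth.
Qed.

Lemma frob_orbitS s g k :
  frob_orbit s g k.+1 = g :: [seq frobv s x | x <- frob_orbit s g k].
Proof.
rewrite /frob_orbit /= muln0 frobv0 -map_comp (iotaDl 1) -map_comp.
by congr (_ :: _); apply: eq_map => i /=; rewrite frobvD mulnS.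
Qed.

Lemma map_frob_orbit s g k :
  [seq frobv s x | x <- frob_orbit s g k] = frob_orbit s (frobv s g) k.
Proof.
by rewrite /frob_orbit -map_comp; apply: eq_map => i /=; rewrite !frobvD addnC.
Qed.

Lemma frob_orbit_sub s g k :
  {subset frob_orbit s g k <= frob_orbit s g k.+1}.
Proof.
by move=> x; rewrite /frob_orbit -[k.+1]addn1 iotaD map_cat mem_cat => ->.
Qed.

Lemma gabidulin_rowsE k s g :
  [seq row i (gabidulin_mx k s g) | i : 'I_k] = frob_orbit s g k.
Proof.
rewrite /frob_orbit -val_enum_ord -map_comp; apply: eq_map => i /=.
exact: rowK.
Qed.

(** * Frobenius-stable subspaces and orbit generators *)

Lemma frob_fixed_mem1 s (a : L) :
  coprime s (\dim {:L}) -> a ^+ (#|F| ^ s) = a -> a \in 1%VS.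
Proof.
set m := \dim _ => cop_sm fix_s.
have fix_m : a ^+ (#|F| ^ m) = a.
  by apply/eqP; rewrite -(Fermat's_little_theorem {:L}%AS) memvf.
have fixM u j : a ^+ (#|F| ^ u) = a -> a ^+ (#|F| ^ (j * u)) = a.
  move=> fix_u; elim: j => [|j IHj]; first by rewrite mul0n expn0 expr1.
  by rewrite mulSn expnD exprM fix_u.
rewrite (Fermat's_little_theorem 1%AS) dimv1 expn1; apply/eqP.
have m_gt0 : (0 < m)%N by apply: (adim_gt0 {:L}%AS).
(* Bezout in the subtraction-free form [u * s + 1 = v * m]: being fixed by the powers [u * s] and
   [v * m] of Frobenius, [a] satisfies [a ^+ #|F| = a]. *)
have [u _ /dvdnP[v Euv]] := Bezoutl s m_gt0.
move: Euv; rewrite gcdnC (eqP cop_sm) addnC => Euv.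
have := fixM _ v fix_m; rewrite -Euv addnC expnD expn1 mulnC exprM.
by rewrite fixM.
Qed.

Lemma frob_stable_rank1 s D :
    coprime s (\dim {:L}) -> D != 0%VS -> (frob_code s D <= D)%VS ->
  exists c, [/\ c \in D, c != 0 & (rank_weight c <= 1)%N].
Proof.
move=> cop_sm nzD /subvP stD.
(* Induction on a bound [w] for the Hamming weight replaces the choice of a lightest word. *)
suff IH w c : c \in D -> c != 0 -> (#|[set j | c 0%R j != 0%R]| <= w)%N ->
    exists c, [/\ c \in D, c != 0 & (rank_weight c <= 1)%N].
  by apply: (IH _ (vpick D)); rewrite ?memv_pick ?vpick0.
elim: w c => [|w IHw] c Dc nzc.
  rewrite leqn0 cards_eq0 => /eqP supp0; case/eqP: nzc; apply/rowP=> j.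
  by apply/eqP; have := in_set0 j; rewrite -supp0 inE mxE => /negbFE.
have [j nzcj] : exists j, c 0 j != 0 by apply/rV0Pn.
pose c1 := (c 0 j)^-1 *: c; pose d := frobv s c1 - c1 => le_c_w.
have Dc1 : c1 \in D by apply: memvZ.
have [d0 | nzd] := eqVneq d 0.
  exists c1; split=> //; first by rewrite scaler_eq0 invr_eq0 negb_or nzcj.
  have dim1 : \dim (1%VS : {vspace L}) = 1%N := dimv1 L.
  rewrite -dim1; apply/dimvS/span_subvP=> _ /imageP[i _ ->].
  apply: frob_fixed_mem1 cop_sm _.
  by move/eqP: d0; rewrite subr_eq0 => /eqP/rowP/(_ i); rewrite mxE.
apply: (IHw d) => //.
  by apply: memvB => //; apply/stD/frob_codeP; exists c1.
(* [d] vanishes wherever [c] does, and also at [j], where the entry of [c1] is 1. *)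
rewrite -ltnS (leq_trans _ le_c_w) //; apply/proper_card/properP; split.
  apply/subsetP=> i; rewrite !inE !mxE; apply: contraNN => /eqP->.
  by rewrite mulr0 expr0n gtn_eqF ?subrr // expn_gt0 (ltnW (finNzRing_gt1 F)).
by exists j; rewrite !inE ?nzcj // !mxE mulVf // expr1n subrr eqxx.
Qed.

Lemma orbit_of_corank1 s k C :
    \dim C = k.+1 -> \dim (C :&: frob_code s C)%VS = k ->
    (forall D, (D <= C)%VS -> (frob_code s D <= D)%VS -> D = 0%VS) ->
  exists g, C = <<frob_orbit s g k.+1>>%VS.
Proof.
elim: k C => [|k IHk] C dimC dimD unstable.
  exists (vpick C); rewrite /frob_orbit /= muln0 frobv0 span_seq1.
  apply/esym/eqP; rewrite eqEdim -memvE memv_pick dim_vline dimC vpick0.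
  by rewrite -dimv_eq0 dimC.
set D := (C :&: _)%VS in dimD.
have sDC : (D <= C)%VS by apply: capvSl.
have sDsC : (D <= frob_code s C)%VS by apply: capvSr.
have unstableD : ~~ (frob_code s D <= D)%VS.
  by apply/negP=> /(unstable D sDC) /eqP; rewrite -dimv_eq0 dimD.
have [|E sED stE|h Dh] := IHk D dimD; last 1 first.
- have /frob_codeP[g Cg Dgh] : h \in frob_code s C.
    apply: (subvP sDsC); rewrite Dh; apply: memv_span.
    by rewrite frob_orbitS mem_head.
  exists g; rewrite frob_orbitS map_frob_orbit -Dgh span_cons -Dh.
  (* Otherwise the first [k.+1] orbit vectors of [g] lie in [D], while their Frobenius images span
     [D]; equal dimensions would make [D] stable. *)
  have gD' : g \notin D.
    apply: contra unstableD => Dg.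
    have sED : (<<frob_orbit s g k.+1>> <= D)%VS.
      rewrite frob_orbitS span_cons subv_add -memvE Dg /= map_frob_orbit -Dgh.
      rewrite Dh; exact/sub_span/frob_orbit_sub.
    have sE : frob_code s <<frob_orbit s g k.+1>> = D.
      by rewrite frob_code_span map_frob_orbit -Dgh -Dh.
    have ED : <<frob_orbit s g k.+1>>%VS = D.
      by apply/eqP; rewrite eqEdim sED -sE dim_frob_code /=.
    by rewrite -{1}ED sE.
  apply/esym/eqP; rewrite eqEdim subv_add -memvE Cg sDC dimC -dimD ltnNge /=.
  apply: contra gD' => le_dim; rewrite memvE (subv_trans (addvSl _ D)) //.
  have: D == (<[g]> + D)%VS by rewrite eqEdim addvSr.
  by move/eqP <-.
(* The intersection of [D] with its image is proper by instability, and loses only one dimension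
   because both lie in [frob_code s C], of dimension [k.+2]. *)
- apply/eqP; rewrite eqn_leq; apply/andP; split.
    rewrite -ltnS -dimD ltnNge; apply: contra unstableD => le_dim.
    have: (D :&: frob_code s D)%VS == D by rewrite eqEdim capvSl.
    move/eqP=> DI; have: D == frob_code s D.
      by rewrite eqEdim dim_frob_code leqnn andbT -{1}DI capvSr.
    by move/eqP <-.
  have := dimv_sum_cap D (frob_code s D); rewrite dim_frob_code dimD => Edim.
  have: (\dim (D + frob_code s D) <= k.+2)%N.
    rewrite -dimC -(dim_frob_code s C); apply: dimvS.
    by rewrite subv_add sDsC frob_code_mono.
  by rewrite -(leq_add2r (\dim (D :&: frob_code s D))) Edim addSn addnS !addSn
             !ltnS leq_add2l.
by apply: unstable stE; apply: subv_trans sDC.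
Qed.

(** * Codewords of small rank *)

Lemma exists_vanishing C (r : seq 'I_n) :
    (size r < \dim C)%N ->
  exists c, [/\ c \in C, c != 0 & forall i, i \in r -> c 0 i = 0].
Proof.
move=> lt_r_C.
(* Restriction to the coordinates in [r] has a target too small for it to be injective on [C]. *)
pose f := linfun (colsub (tnth (in_tuple r)) : 'rV[L]_n -> 'rV_ _).
pose K := (C :&: lker f)%VS.
have nzK : K != 0%VS.
  rewrite -dimv_eq0 -lt0n -(ltn_add2r (\dim (f @: C))) limg_ker_dim add0n.
  apply: leq_ltn_trans lt_r_C; rewrite (leq_trans (dimvS (subvf _))) //.
  by rewrite dimvf /dim /= mul1n.
have := memv_pick K; rewrite memv_cap memv_ker lfunE /= => /andP[Cc /eqP fc0].
exists (vpick K); split; rewrite ?vpick0 // => i /(tnthP (in_tuple r))[j ->].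
by move/rowP/(_ j): fc0; rewrite !mxE.
Qed.

(** Scalars of [F] are fixed by Frobenius, so powers of the relation hold for each orbit vector,
    hence for their [L]-combinations. *)
Lemma frob_orbit_relation s g k (lam : 'I_n -> F) c :
    \sum_i lam i *: g 0 i = 0 -> c \in <<frob_orbit s g k>>%VS ->
  \sum_i lam i *: c 0 i = 0.
Proof.
have lam_fix t (a : F) : a ^+ (#|F| ^ t) = a.
  by elim: t => [|t IHt]; rewrite ?expr1 // expnS exprM expf_card.
move=> rel_g /(@coord_span _ _ _ (in_tuple _)) ->.
under eq_bigr => i _ do rewrite summxE scaler_sumr.
rewrite exchange_big big1 //= => j _.
have /mapP[t _ ->] : (frob_orbit s g k)`_j \in frob_orbit s g k.
  by rewrite mem_nth.
transitivity (coord (in_tuple (frob_orbit s g k)) j c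
              * (\sum_i lam i *: g 0 i) ^+ (#|F| ^ (s * t))); last first.
  by rewrite rel_g expr0n gtn_eqF ?mulr0 // expn_gt0 (ltnW (finNzRing_gt1 F)).
rewrite (big_morph (fun a : L => a ^+ _) (@frob_add F L (s * t)) (id1 := 0)).
  rewrite mulr_sumr; apply: eq_bigr => i _.
  by rewrite !mxE exprZn lam_fix scalerAr.
by rewrite expr0n gtn_eqF // expn_gt0 (ltnW (finNzRing_gt1 F)).
Qed.

(** The entry at [i0] is an [F]-combination of the others. Killing [\dim C - 1] of those leaves
    [n - \dim C] entries to span the rest. *)
Lemma rank_weight_relation C (lam : 'I_n -> F) i0 :
    (0 < \dim C)%N -> lam i0 != 0 ->
    (forall c, c \in C -> \sum_i lam i *: c 0 i = 0) ->
  exists c, [/\ c \in C, c != 0 & (rank_weight c <= n - \dim C)%N].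
Proof.
move=> C_gt0 nz_lam rel; set k := \dim C.
pose others := enum (predC1 i0).
have size_others : size others = n.-1 by rewrite -cardE cardC1 card_ord.
have [|c [Cc nzc c_r]] := @exists_vanishing C (take k.-1 others).
  by rewrite size_take_min (leq_ltn_trans (geq_minl _ _)) ?prednK.
exists c; split=> //; set r' := drop k.-1 others.
have c_others i : i != i0 -> c 0 i \in <<[seq c 0%R j | j <- r']>>%VS.
  move=> ne_i; have: i \in others by rewrite mem_enum inE.
  rewrite -(cat_take_drop k.-1 others) mem_cat => /orP[/c_r -> | r'i].
    exact: mem0v.
  exact/memv_span/map_f.
apply: (@leq_trans (\dim <<[seq c 0%R j | j <- r']>>%VS)).
  apply/dimvS/span_subvP=> _ /imageP[i _ ->].
  have [-> | /c_others//] := eqVneq i i0.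
  move/eqP: (rel c Cc); rewrite (bigD1 i0) //= addr_eq0 => /eqP Ec.
  rewrite -[c 0 i0](scalerK nz_lam) Ec; apply/memvZ; rewrite memvN.
  by apply: memv_suml => j /c_others; apply: memvZ.
rewrite (leq_trans (dim_span _)) // size_map size_drop size_others.
by rewrite -[n.-1]subn1 -subnDA add1n prednK.
Qed.

End FrobeniusOrbits.

Theorem theorem4p8 (F : finFieldType) (L : fieldExtType F) (m n k s : nat)
    (C : {vspace 'rV[L]_n}) :
  \dim {:L} = m -> (0 < m)%N -> (0 < n)%N ->
  (s < m)%N -> coprime s m ->
  is_MRD C -> \dim C = k -> (k < n)%N ->
  \dim (C :&: frob_code s C)%VS = (k - 1)%N <-> is_gen_gabidulin k s C.
Proof.
move=> dimL _ _ _ cop_sm [nzC [_ dist]] dimC lt_kn.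
have light c : c \in C -> c != 0 -> ~~ (rank_weight c <= n - k)%N.
  by move=> Cc nzc; rewrite -ltnNge -addn1 -dimC dist.
have unstable D : (D <= C)%VS -> (frob_code s D <= D)%VS -> D = 0%VS.
  move=> sDC stD; apply/eqP/negPn/negP=> nzD.
  have [|c [Dc nzc rk1]] := frob_stable_rank1 _ nzD stD; first by rewrite dimL.
  case/negP: (light c (subvP sDC c Dc) nzc).
  by rewrite (leq_trans rk1) // subn_gt0.
(* The MRD code is nonzero, so [k - 1] is not truncated; from here on [k] denotes the dimension
   minus one. *)
case: k => [|k] in dimC lt_kn light *.
  by move: nzC; rewrite -dimv_eq0 dimC.
rewrite subn1 /=; split=> [dimD | [g [_]]].
  have [g Cg] := orbit_of_corank1 dimC dimD unstable.
  exists g; split; last first.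
    rewrite /is_generator_matrix gabidulin_rowsE basisEdim -Cg subvv dimC.
    by rewrite size_map size_iota leqnn.
  have -> : [seq g 0 i | i : 'I_n] = [tuple g 0 i | i < n] :> seq L.
    by rewrite /= /image_mem enumT.
  apply/freeP=> lam rel_g i0; apply/eqP/negPn/negP=> nz_lam.
  have [||c [Cc nzc]] := @rank_weight_relation _ _ _ C lam i0 _ nz_lam.
  - by rewrite dimC.
  - move=> c; rewrite Cg; apply: frob_orbit_relation.
    rewrite -[RHS]rel_g; apply: eq_bigr => i _.
    by rewrite -tnth_nth tnth_mktuple.
  by rewrite dimC; apply/negP/light.
(* Conversely, all basis vectors but the first are Frobenius images of basis vectors: these [k] free
   vectors lie in the intersection. *)
rewrite /is_generator_matrix gabidulin_rowsE => basisC.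
have := basis_free basisC; rewrite frob_orbitS free_cons => /andP[_ free_tl].
apply/eqP; rewrite eqn_leq; apply/andP; split.
  (* A larger intersection would be all of [C], making [C] itself stable. *)
  rewrite -ltnS -dimC ltnNge; apply/negP=> le_dim.
  have: (C :&: frob_code s C)%VS == C by rewrite eqEdim capvSl.
  move/eqP=> CI; have: C == frob_code s C.
    by rewrite eqEdim dim_frob_code leqnn andbT -{1}CI capvSr.
  move/eqP=> stC; case/eqP: nzC; apply: unstable => //.
  by rewrite -stC.
have <- : size [seq frobv s x | x <- frob_orbit s g k] = k.
  by rewrite !size_map size_iota.
rewrite -(eqP free_tl); apply: dimvS; rewrite subv_cap; apply/andP; split.
  by rewrite -(span_basis basisC) frob_orbitS span_cons addvSr.
rewrite -frob_code_span; apply: frob_code_mono.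
rewrite -(span_basis basisC); exact/sub_span/frob_orbit_sub.
Qed.
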